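(* Let $V=(e_1,e_2,\ldots)$ with $e_i\in\{0,1\}$ be an infinite binary vector containing infinitely many terms equal to $1$. Then $V$ is realizable if and only if $\lim_{j\to+\infty}\dfrac{N_{0,j}(V)}{2^{j}}=0$; and $V$ is non-realizable if and only if the sequence $\left(\dfrac{N_{0,j}(V)}{2^{j}}\right)_{j\ge1}$ does not converge to $0$.
   Context: The Collatz map $T:\mathbb{N}^*\to\mathbb{N}^*$ (where $\mathbb{N}^*$ is the set of positive integers) is $T(N)=N/2$ if $N$ is even and $T(N)=(3N+1)/2$ if $N$ is odd. For an integer $N$ let $\mathbf{i}(N)=0$ if $N$ is even and $\mathbf{i}(N)=1$ if $N$ is odd. For $N\in\mathbb{N}^*$ and $n\ge1$, put $v_n(N)=(\mathbf{i}(N),\mathbf{i}(T(N)),\ldots,\mathbf{i}(T^{n-1}(N)))$ and $v_\infty(N)=(\mathbf{i}(N),\mathbf{i}(T(N)),\mathbf{i}(T^2(N)),\ldots)$. An infinite binary vector $V$ is called realizable (convertible into a Collatz sequence) if there exists a positive integer $N$ with $v_\infty(N)=V$, and non-realizable otherwise. For $V=(e_1,e_2,\ldots)$ and $j\ge1$, put $R_j(V)=(e_1,\ldots,e_j)$, and let $N_{0,j}(V)$ be the least positive integer $N$ such that $v_j(N)=R_j(V)$ (it exists and satisfies $1\le N_{0,j}(V)\le 2^j$). *)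

(* Defs.v *)
From mathcomp Require Import all_boot zify.
Set Implicit Arguments.
Unset Strict Implicit.
Unset Printing Implicit Defensive.

Local Open Scope nat_scope.

(* [collatz] is total on nat; it maps positive integers to positive integers
   (see [collatz_gt0]) and only its values there are used. *)
Definition collatz (N : nat) : nat :=
  if odd N then (3 * N + 1) %/ 2 else N %/ 2.

Lemma collatz_gt0 N : 0 < N -> 0 < collatz N.
Proof. by rewrite /collatz; case: ifP => odN N_gt0; lia. Qed.

(* Parity bits are booleans, [true] standing for 1: the bit i(N) is [odd N].
   Infinite vectors (e_1, e_2, ...) are functions V : nat -> bool indexed
   from 0, so that V k is e_(k+1). *)
Definition v_infty (N : nat) : nat -> bool := fun k => odd (iter k collatz N).

Definition v_ (n N : nat) : seq bool :=
  mkseq (fun k => odd (iter k collatz N)) n.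

Definition truncation (j : nat) (V : nat -> bool) : seq bool := mkseq V j.

Definition realizable (V : nat -> bool) : Prop :=
  exists N : nat, 0 < N /\ v_infty N =1 V.

Definition non_realizable (V : nat -> bool) : Prop := ~ realizable V.

Lemma v_S n N : v_ n.+1 N = odd N :: v_ n (collatz N).
Proof.
rewrite /v_ /mkseq /= -[1]/(1 + 0) iotaDl -map_comp; congr (_ :: _).
by apply: eq_map => k /=; rewrite -iterS iterSr.
Qed.

Lemma truncation_S j V :
  truncation j.+1 V = V 0 :: truncation j (fun k => V k.+1).
Proof. by rewrite /truncation /mkseq /= -[1]/(1 + 0) iotaDl -map_comp. Qed.

Lemma v_periodic j N k : v_ j (N + 2 ^ j * k) = v_ j N.
Proof.
elim: j N k => [//|j IHj] N k; rewrite !v_S expnS -mulnA.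
have -> : odd (N + 2 * (2 ^ j * k)) = odd N by lia.
congr (_ :: _); rewrite /collatz.
have -> : odd (N + 2 * (2 ^ j * k)) = odd N by lia.
case: ifP => odN.
- rewrite -[RHS](IHj _ (3 * k)) [2 ^ j * (3 * k)]mulnCA; congr (v_ j _).
  by move: (2 ^ j * k) => m; lia.
- rewrite -[RHS](IHj _ k); congr (v_ j _).
  by move: (2 ^ j * k) => m; lia.
Qed.

Lemma truncation_attained (V : nat -> bool) (j : nat) :
  exists N : nat, (0 < N) && (v_ j N == truncation j V).
Proof.
elim: j V => [|j IHj] V; first by exists 1.
have [N /andP[N_gt0 /eqP vN]] := IHj (fun k => V k.+1).
case V0: (V 0); last first.
  exists (2 * N); rewrite v_S truncation_S V0 /collatz.
  have -> : odd (2 * N) = false by lia.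
  have -> : 2 * N %/ 2 = N by lia.
  by rewrite vN eqxx andbT; lia.
(* Shift N by a multiple of 2 ^ j to a number congruent to 2 modulo 3. *)
pose M := N + 2 ^ j * (2 ^ j * (2 + 2 * N)).
have [q Mq] : exists q, M = 3 * q + 2.
  have [c ec] : exists c, 2 ^ j * 2 ^ j = 3 * c + 1.
    elim: (j) => [|i [c ec]]; first by exists 0.
    by exists (4 * c + 1); rewrite expnS mulnACA ec; lia.
  exists (N + c * (2 + 2 * N)); rewrite /M mulnA ec mulnDl -mulnA; lia.
exists (2 * q + 1); rewrite v_S truncation_S V0 /collatz.
have -> : odd (2 * q + 1) by lia.
have -> : (3 * (2 * q + 1) + 1) %/ 2 = M by lia.
by rewrite /M v_periodic vN eqxx andbT; lia.
Qed.

Definition N0 (j : nat) (V : nat -> bool) : nat :=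
  ex_minn (truncation_attained V j).

(* Main.v *)
Require Import Defs.
From mathcomp Require Import all_boot all_order all_algebra.
From mathcomp Require Import all_classical all_reals all_analysis.
From mathcomp Require Import zify.
Import numFieldNormedType.Exports.
Import Order.TTheory GRing.Theory Num.Theory.
Local Open Scope classical_set_scope.
Local Open Scope ring_scope.

(** The parity vector of length [j] determines an integer modulo [2 ^ j]
    ([v_inj_mod]), so the admissible starting values at level [j] form one
    residue class modulo [2 ^ j], of which [N0 j V] is the least positive
    element.

    If [N] realizes [V], then [N] is admissible at every level, so
    [N0 j V <= N] and the ratio is dominated by [N / 2 ^ j], which tends to 0.

    Conversely, [N0 j.+1 V] lies in the class of [N0 j V] modulo [2 ^ j].  Thus
    it is either [N0 j V] or at least [2 ^ j], and in the latter case the ratio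
    at level [j.+1] is at least 1/2.  If the ratios tend to 0, this happens only
    finitely often ([N0_step]), so [N0 j V] is eventually constant; its final
    value is admissible at every level, that is, it realizes [V]
    ([realizable_of_small_N0]).  The statement on non-realizability is the
    contrapositive. *)

(** Since the two integers share their first parity bit, the difference of
    their [collatz] images is the original difference multiplied by 1/2 or 3/2;
    as 3 is invertible modulo [2 ^ j], each bit contributes exactly one factor
    2 to the difference. *)
Lemma v_inj_mod (j M N : nat) :
  (M <= N)%N -> v_ j M = v_ j N -> (2 ^ j %| N - M)%N.
Proof.
elim: j M N => [|j IHj] M N leMN; first by rewrite expn0 dvd1n.
rewrite !v_S => -[oMN /IHj]; rewrite expnS /collatz -oMN.
case: ifP oMN => oM oN dvdT.
- rewrite -(@Gauss_dvdr _ 3) -?expnS ?coprimeXl // expnS.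
  have -> : (3 * (N - M) = 2 * ((3 * N + 1) %/ 2 - (3 * M + 1) %/ 2))%N by lia.
  by rewrite dvdn_pmul2l // dvdT //; lia.
- have -> : (N - M = 2 * (N %/ 2 - M %/ 2))%N by lia.
  by rewrite dvdn_pmul2l // dvdT //; lia.
Qed.

Lemma N0_gt0 (j : nat) (V : nat -> bool) : (0 < N0 j V)%N.
Proof. by rewrite /N0; case: ex_minnP => n /andP[]. Qed.

Lemma v_N0 (j : nat) (V : nat -> bool) : v_ j (N0 j V) = truncation j V.
Proof. by rewrite /N0; case: ex_minnP => n /andP[_ /eqP]. Qed.

Lemma N0_min (j : nat) (V : nat -> bool) (N : nat) :
  (0 < N)%N -> v_ j N = truncation j V -> (N0 j V <= N)%N.
Proof.
by move=> N_gt0 vN; rewrite /N0; case: ex_minnP => n _; apply; rewrite N_gt0 vN /=.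
Qed.

Lemma v_eq_truncation (j N : nat) (V : nat -> bool) :
  v_ j N = truncation j V <-> forall k, (k < j)%N -> v_infty N k = V k.
Proof.
split=> [vN k ltkj|vN].
  by have := congr1 (nth false ^~ k) vN; rewrite /= !nth_mkseq.
apply: (@eq_from_nth _ false) => [|k]; rewrite !size_mkseq // => ltkj.
by rewrite !nth_mkseq //; apply: vN.
Qed.

Lemma N0_le_realizer (N : nat) (V : nat -> bool) (j : nat) :
  (0 < N)%N -> v_infty N =1 V -> (N0 j V <= N)%N.
Proof. by move=> N_gt0 vN; apply: N0_min => //; apply/v_eq_truncation. Qed.

(** Both values lie in the same class modulo [2 ^ j], and the smallness
    assumption leaves no room for two elements of it. *)
Lemma N0_step (j : nat) (V : nat -> bool) :
  (N0 j.+1 V < 2 ^ j)%N -> N0 j.+1 V = N0 j V.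
Proof.
move=> lt_N0.
have vj : v_ j (N0 j.+1 V) = truncation j V.
  apply/v_eq_truncation => k ltkj.
  by have /v_eq_truncation := v_N0 j.+1 V; apply; apply: ltnW.
have leN := N0_min _ _ _ (N0_gt0 j.+1 V) vj.
have := v_inj_mod _ _ _ leN (etrans (v_N0 j V) (esym vj)).
rewrite /dvdn modn_small; last exact: leq_ltn_trans (leq_subr _ _) lt_N0.
by rewrite subn_eq0 => geN; apply/eqP; rewrite eqn_leq geN leN.
Qed.

Lemma realizable_of_small_N0 (V : nat -> bool) (J : nat) :
  (forall j, (J <= j)%N -> (2 * N0 j V < 2 ^ j)%N) -> realizable V.
Proof.
move=> small.
have N0_const d : N0 (J + d) V = N0 J V.
  elim: d => [|d IHd]; first by rewrite addn0.
  rewrite addnS -IHd; apply: N0_step.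
  have := small (J + d).+1; rewrite expnS ltn_pmul2l //; apply.
  by rewrite -addnS leq_addr.
exists (N0 J V); split=> [|k]; first exact: N0_gt0.
have /v_eq_truncation := v_N0 (J + k.+1) V; rewrite N0_const; apply.
by rewrite addnS ltnS leq_addl.
Qed.

Lemma realizable_iff_cvg (R : realType) (V : nat -> bool) :
  realizable V <-> (fun j : nat => (N0 j V)%:R / 2 ^+ j : R) @ \oo --> (0 : R).
Proof.
split=> [[N [N_gt0 vN]]|cvg0].
  apply: (@squeeze_cvgr _ _ _ _ (cst 0) (geometric (N%:R : R) 2^-1)).
  - near=> j; rewrite /= divr_ge0 ?exprn_ge0 //= exprVn.
    by rewrite ler_pM2r ?invr_gt0 ?exprn_gt0 // ler_nat N0_le_realizer.
  - exact: cvg_cst.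
  - by apply: cvg_geometric; rewrite ger0_norm ?invr_ge0 // invf_lt1 // ltr1n.
have half_gt0 : 0 < 2^-1 :> R by rewrite invr_gt0.
have [J _ lt_half] := cvgr_lt _ cvg0 _ half_gt0.
apply: (@realizable_of_small_N0 V J) => j leJj.
have := lt_half j leJj; rewrite /= ltr_pdivrMr ?exprn_gt0 //.
by rewrite ltr_pdivlMl // -natrX -natrM ltr_nat.
Unshelve. all: by end_near. Qed.

Theorem theorem6p2 (R : realType) (V : nat -> bool)
    (V_inf : infinite_set [set k : nat | V k = true]) :
  (realizable V <->
     (fun j : nat => (N0 j V)%:R / 2 ^+ j : R) @ \oo --> (0 : R)) /\
  (non_realizable V <->
     ~ ((fun j : nat => (N0 j V)%:R / 2 ^+ j : R) @ \oo --> (0 : R))).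
Proof.
have rV := realizable_iff_cvg R V.
by split=> //; rewrite /non_realizable rV.
Qed.
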